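(* Let $k,p,n$ be integers with $1\le k<p<n$. Then $$C_{n,p}^2\le\frac{\binom{n}{p-k}}{\binom{p}{k}}\,C_{n,k}^2 .$$
   Context: Let $\Lambda^p(\mathbf{R}^n)$ be the space of $p$-vectors in $\mathbf{R}^n$ with its standard Euclidean norm $|\cdot|$ (for an orthonormal basis $e_1,\dots,e_n$ of $\mathbf{R}^n$, the $p$-vectors $e_{i_1}\wedge\cdots\wedge e_{i_p}$, $i_1<\cdots<i_p$, are orthonormal), and let $\Lambda^p(\mathbf{R}^n)^*$ be its dual space, the space of $p$-covectors, with the dual Euclidean norm $|\cdot|^*$ (the $e_{i_1}^*\wedge\cdots\wedge e_{i_p}^*$ are orthonormal and form the basis dual to the $e_{i_1}\wedge\cdots\wedge e_{i_p}$). A $p$-vector is simple if it is a wedge product of $p$ vectors. The comass of $\phi\in\Lambda^p(\mathbf{R}^n)^*$ is $$\Vert\phi\Vert^*=\sup\{\phi(\xi):\xi\in\Lambda^p(\mathbf{R}^n)\text{ simple},\ |\xi|\le 1\}.$$ Define $$C_{n,p}=\sup\left\{\frac{|\phi|^*}{\Vert\phi\Vert^*}:\phi\in\Lambda^p(\mathbf{R}^n)^*,\ \phi\ne0\right\}.$$ *)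

(* Defs.v *)
From HB Require Import structures.
From mathcomp Require Import all_boot all_order all_fingroup all_algebra.
From mathcomp Require Import all_classical all_reals.

Set Implicit Arguments.
Unset Strict Implicit.
Unset Printing Implicit Defensive.

Import Order.TTheory GRing.Theory Num.Theory.

Local Open Scope classical_set_scope.
Local Open Scope ring_scope.

Definition multi_index (n p : nat) : Type :=
  {I : {ffun 'I_p -> 'I_n}
  | [forall i : 'I_p, forall j : 'I_p, (i < j)%N ==> (I i < I j)%N]}.

HB.instance Definition _ n p := SubFinite.on (multi_index n p).

(* A p-vector is represented by its coordinates in the basis
   e_{I 0} /\ ... /\ e_{I (p-1)} with I increasing (see [wedge_basis]). *)
Definition pvector (R : realType) (n p : nat) : Type :=
  {ffun multi_index n p -> R^o}.

HB.instance Definition _ (R : realType) n p := Vector.on (pvector R n p).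

Definition pcovector (R : realType) (n p : nat) : Type :=
  'Hom(pvector R n p, R^o).

(* Coordinates of v_0 /\ ... /\ v_(p-1): the maximal minors of the matrix whose
   rows are the v_i. *)
Definition wedge (R : realType) (n p : nat) (v : 'I_p -> 'rV[R]_n) :
    pvector R n p :=
  [ffun I : multi_index n p => \det (\matrix_(i, j) v i 0 (val I j))].

Definition simple (R : realType) (n p : nat) (xi : pvector R n p) : Prop :=
  exists v : 'I_p -> 'rV[R]_n, xi = wedge v.

Definition basis_pvector (R : realType) (n p : nat) (I : multi_index n p) :
    pvector R n p :=
  wedge (fun i => delta_mx 0 (val I i)).

Definition pvector_norm (R : realType) (n p : nat) (xi : pvector R n p) : R :=
  Num.sqrt (\sum_I xi I ^+ 2).

(* phi (basis_pvector I) is the coordinate of phi in the dual basis. *)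
Definition pcovector_norm (R : realType) (n p : nat) (phi : pcovector R n p) :
    R :=
  Num.sqrt (\sum_I phi (basis_pvector R I) ^+ 2).

Definition comass (R : realType) (n p : nat) (phi : pcovector R n p) : R :=
  sup [set phi xi | xi in [set xi | simple xi /\ pvector_norm xi <= 1]].

Definition comass_const (R : realType) (n p : nat) : R :=
  sup [set pcovector_norm phi / comass phi
      | phi in [set phi : pcovector R n p | phi != 0]].

Lemma multi_index_inj n p (I : multi_index n p) : injective (val I).
Proof.
move=> i j eqI; apply/val_inj; case: (ltngtP i j) => // lt_ij.
  by have := forallP (forallP (valP I) i) j; rewrite lt_ij eqI ltnn.
by have := forallP (forallP (valP I) j) i; rewrite lt_ij eqI ltnn.
Qed.

Lemma multi_index_eq n p (I J : multi_index n p) :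
  (forall i, val I i \in codom (val J)) -> I = J.
Proof.
move=> sIJ; apply/val_inj/ffunP => i.
have srt (K : multi_index n p) : sorted ltn [seq val k | k <- codom (val K)].
  rewrite /codom /image_mem -map_comp sorted_map.
  have : sorted ltn [seq val k | k <- enum 'I_p].
    by rewrite val_enum_ord iota_ltn_sorted.
  rewrite sorted_map; apply: sub_sorted => a b /= lt_ab.
  by have := forallP (forallP (valP K) a) b; rewrite lt_ab.
have unq (K : multi_index n p) : uniq (codom (val K)).
  by rewrite map_inj_uniq ?enum_uniq //; exact: multi_index_inj.
have eqm : codom (val I) =i codom (val J).
  apply: (uniq_min_size (unq I) _ _).2; last by rewrite !size_codom.
  by move=> x /codomP[k ->].
have eqc : codom (val I) = codom (val J).
  apply: (inj_map val_inj); apply: (irr_sorted_eq ltn_trans ltnn) => //.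
  by move=> x; apply/mapP/mapP => -[k kI ->]; exists k; rewrite // ?eqm // -eqm.
have := congr1 (fun s => nth (val I i) s (enum_rank i)) eqc.
by rewrite /= !nth_codom ?enum_rankK // enum_rankK.
Qed.

Lemma wedge_basis (R : realType) (n p : nat) (I J : multi_index n p) :
  basis_pvector R I J = (J == I)%:R.
Proof.
rewrite /basis_pvector /wedge ffunE; have [->|neqJI] := eqVneq J I.
  rewrite -[RHS](det1 R p); congr (\det _); apply/matrixP => i j.
  by rewrite !mxE eqxx /= (inj_eq (@multi_index_inj _ _ I)) eq_sym.
have /existsP[i iNJ] : [exists i, val I i \notin codom (val J)].
  apply: contraNT neqJI => /existsPn sIJ; rewrite eq_sym.
  by apply/eqP/multi_index_eq => i; have := sIJ i; rewrite negbK.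
rewrite (expand_det_row _ i) big1 // => j _; rewrite !mxE eqxx /=.
case: eqP => [eqJI|]; last by rewrite mul0r.
by rewrite -eqJI codom_f in iNJ.
Qed.

Lemma wedge_scale (R : realType) (n p : nat) (i0 : 'I_p) (a : R)
    (v : 'I_p -> 'rV[R]_n) :
  wedge (fun i => if i == i0 then a *: v i else v i) = a *: wedge v.
Proof.
apply/ffunP => I; rewrite !ffunE.
set A := (X in \det X = _); set B := (X in _ = _ *: \det X).
rewrite (@determinant_multilinear _ _ A B B i0 a 0) ?mul0r ?addr0 //.
- by apply/rowP => j; rewrite !mxE eqxx !mxE mul0r addr0.
- by apply/matrixP => i j; rewrite !mxE eq_sym (negbTE (neq_lift _ _)).
- by apply/matrixP => i j; rewrite !mxE eq_sym (negbTE (neq_lift _ _)).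
Qed.

Lemma wedge_add (R : realType) (n p : nat) (i0 : 'I_p) (u w : 'rV[R]_n)
    (v : 'I_p -> 'rV[R]_n) :
  wedge (fun i => if i == i0 then u + w else v i) =
  wedge (fun i => if i == i0 then u else v i) +
  wedge (fun i => if i == i0 then w else v i).
Proof.
apply/ffunP => I; rewrite !ffunE.
set A := (X in \det X = _); set B := (X in _ = \det X + _).
set C := (X in _ = _ + \det X).
rewrite (@determinant_multilinear _ _ A B C i0 1 1) ?mul1r //.
- by apply/rowP => j; rewrite !mxE eqxx !mxE !mul1r.
- by apply/matrixP => i j; rewrite !mxE eq_sym (negbTE (neq_lift _ _)).
- by apply/matrixP => i j; rewrite !mxE eq_sym (negbTE (neq_lift _ _)).
Qed.

Lemma wedge_alternating (R : realType) (n p : nat) (i1 i2 : 'I_p)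
    (v : 'I_p -> 'rV[R]_n) :
  i1 != i2 -> v i1 = v i2 -> wedge v = 0.
Proof.
move=> neq12 eq12; apply/ffunP => I; rewrite !ffunE.
by apply: (determinant_alternate neq12) => j; rewrite !mxE eq12.
Qed.

Lemma pvector_sum (R : realType) (n p : nat) (xi : pvector R n p) :
  xi = \sum_I xi I *: basis_pvector R I.
Proof.
apply/ffunP => J; rewrite sum_ffunE (bigD1 J) //= big1 ?addr0 => [|I neqIJ].
  by rewrite ffunE wedge_basis eqxx [RHS]mulr1.
by rewrite ffunE wedge_basis eq_sym (negbTE neqIJ) [LHS]mulr0.
Qed.

Lemma pcovector_sum (R : realType) (n p : nat) (phi : pcovector R n p)
    (xi : pvector R n p) :
  phi xi = \sum_I xi I * phi (basis_pvector R I).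
Proof.
by rewrite {1}[xi]pvector_sum linear_sum; apply: eq_bigr => I _; rewrite linearZ.
Qed.

Lemma basis_pvector_norm (R : realType) (n p : nat) (I : multi_index n p) (a : R) :
  pvector_norm (a *: basis_pvector R I) = `|a|.
Proof.
rewrite /pvector_norm (bigD1 I) //= big1 ?addr0 => [|J neqJI].
  by rewrite ffunE wedge_basis eqxx [_ *: _]mulr1 sqrtr_sqr.
by rewrite ffunE wedge_basis (negbTE neqJI) [_ *: _]mulr0 expr0n.
Qed.

Lemma comass_has_sup (R : realType) (n p : nat) (phi : pcovector R n p) :
  (0 < p)%N ->
  has_sup [set phi xi | xi in [set xi | simple xi /\ pvector_norm xi <= 1]].
Proof.
move=> p_gt0; split.
  exists (phi (0 *: wedge (fun=> 0))), (0 *: wedge (fun=> 0)) => //; split.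
    by rewrite -(wedge_scale (Ordinal p_gt0)); eexists.
  rewrite scale0r /pvector_norm big1 ?sqrtr0 ?ler01 // => I _.
  by rewrite ffunE expr0n.
exists (\sum_I `|phi (basis_pvector R I)|) => _ [xi [_ xi_le1] <-].
rewrite pcovector_sum; apply: ler_sum => I _.
apply: le_trans (ler_norm _) _; rewrite normrM ler_piMl //.
rewrite -sqrtr_sqr; apply: le_trans xi_le1; apply: ler_wsqrtr.
by rewrite (bigD1 I) //= lerDl sumr_ge0 // => J _; rewrite sqr_ge0.
Qed.

Lemma comass_basis (R : realType) (n p : nat) (phi : pcovector R n p)
    (I : multi_index n p) :
  (0 < p)%N -> `|phi (basis_pvector R I)| <= comass phi.
Proof.
move=> p_gt0; have cI (a : R) : `|a| <= 1 ->
    a * phi (basis_pvector R I) <= comass phi.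
  move=> a_le1; apply: ub_le_sup; first exact: (comass_has_sup phi p_gt0).2.
  exists (a *: basis_pvector R I); last by rewrite linearZ.
  split; last by rewrite basis_pvector_norm.
  by rewrite /basis_pvector -(wedge_scale (Ordinal p_gt0)); eexists.
rewrite ler_norml lerNl -mulN1r cI ?normrN1 //= -[leLHS]mul1r cI //.
by rewrite normr1.
Qed.

Lemma comass_gt0 (R : realType) (n p : nat) (phi : pcovector R n p) :
  (0 < p)%N -> phi != 0 -> 0 < comass phi.
Proof.
move=> p_gt0; rewrite ltNge; apply: contra => comass_le0; apply/eqP/lfunP => xi.
rewrite lfunE pcovector_sum big1 // => I _; apply/eqP; rewrite mulf_eq0; apply/orP.
by right; rewrite -normr_le0; apply: le_trans comass_le0; exact: comass_basis.
Qed.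

Lemma comass_const_has_sup (R : realType) (n p : nat) :
  (0 < p <= n)%N ->
  has_sup [set pcovector_norm phi / comass phi
          | phi in [set phi : pcovector R n p | phi != 0]].
Proof.
case/andP=> p_gt0 le_pn; split.
  have Iinc : [forall i : 'I_p, forall j : 'I_p, (i < j)%N ==>
      ([ffun k => widen_ord le_pn k] i < [ffun k => widen_ord le_pn k] j)%N].
    by apply/forallP => i; apply/forallP => j; rewrite !ffunE /=; apply/implyP.
  pose I : multi_index n p := exist _ [ffun k => widen_ord le_pn k] Iinc.
  have cI_lin : linear (fun xi : pvector R n p => xi I : R^o).
    by move=> a u v; rewrite !ffunE.
  pose cL := GRing.isLinear.Build _ _ _ _ _ cI_lin.
  pose cI : {linear pvector R n p -> R^o} :=
    HB.pack (fun xi : pvector R n p => xi I : R^o) cL.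
  have cI_neq0 : linfun cI != 0.
    apply/eqP => /lfunP/(_ (basis_pvector R I)).
    by rewrite !lfunE /= wedge_basis eqxx; apply/eqP/oner_neq0.
  by exists (pcovector_norm (linfun cI) / comass (linfun cI)), (linfun cI).
exists (Num.sqrt #|{: multi_index n p}|%:R) => _ [phi phi_neq0 <-].
have c_gt0 := comass_gt0 p_gt0 phi_neq0.
rewrite ler_pdivrMr // -[leRHS]ger0_norm; last first.
  by rewrite mulr_ge0 ?sqrtr_ge0 // ltW.
rewrite -sqrtr_sqr /pcovector_norm; apply: ler_wsqrtr.
rewrite exprMn sqr_sqrtr ?ler0n //.
rewrite mulr_natl -sumr_const; apply: ler_sum => I _.
rewrite -(real_normK (num_real _)) ler_sqr ?nnegrE ?(ltW c_gt0) //.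
exact: comass_basis.
Qed.

(* Main.v *)
From HB Require Import structures.
Require Import Defs.
From mathcomp Require Import all_boot all_order all_algebra.
From mathcomp Require Import all_classical all_reals.

(** For a p-covector phi and a basis vector e_j, let phi_j be the contraction
    xi |-> phi (e_j /\ xi), a (p-1)-covector.  Two facts carry the proof.

    - Wedging with the unit vector e_j keeps simple multivectors simple
      ([wedge_wcons]) and does not increase the norm ([pvector_norm_evwedge]),
      so the comass of phi_j is at most that of phi ([comass_contraction]).
    - Every I of length p is split in exactly p ways into one entry j and the
      remaining multi-index K, and e_j /\ e_K = +- e_I ([evwedge_basis]); so
      the squares of the norms of the phi_j add up to at least p times the
      square of the norm of phi ([sum_contraction_norm]).

    Contracting p - k times leads to k-covectors phi_J, where J ranges over
    sequences of p - k indices.  Only sequences without repetition count, since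
    a covector already contracted by e_j vanishes on every wedge with a factor
    e_j.  There are n (n-1) ... (n-p+k+1) of them, each phi_J has norm at most
    C_{n,k} times the comass of phi by the first fact, and iterating the second
    one gives the factor p (p-1) ... (k+1) on the other side.
    Dividing both falling factorials by (p-k)! gives the binomial coefficients.
    The induction in [norm_le_comass_kills] organizes this, with the set A
    recording the indices already used. *)

Set Implicit Arguments.
Unset Strict Implicit.
Unset Printing Implicit Defensive.

Import Order.TTheory GRing.Theory Num.Theory.

Local Open Scope ring_scope.

(** * Removing an entry from a multi-index *)

Lemma mi_remove_proof n p (I : multi_index n p.+1) (a : 'I_p.+1) :
  [forall i : 'I_p, forall j : 'I_p, (i < j)%N ==>
    ([ffun b => val I (lift a b)] i < [ffun b => val I (lift a b)] j)%N].
Proof.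
apply/forallP => i; apply/forallP => j; apply/implyP => lt_ij; rewrite !ffunE.
have /forallP/(_ (lift a i))/forallP/(_ (lift a j))/implyP := valP I; apply.
by rewrite /= ltnNge leq_bump2 -ltnNge.
Qed.

Definition mi_remove n p (I : multi_index n p.+1) (a : 'I_p.+1) :
    multi_index n p :=
  exist _ [ffun b => val I (lift a b)] (mi_remove_proof I a).

Lemma mi_removeE n p (I : multi_index n p.+1) a b :
  val (mi_remove I a) b = val I (lift a b).
Proof. by rewrite ffunE. Qed.

(** The removed entry and the remaining ones determine the set of entries, hence
    the increasing sequence. *)
Lemma mi_remove_inj n p :
  injective (fun Ia : multi_index n p.+1 * 'I_p.+1 =>
    (val Ia.1 Ia.2, mi_remove Ia.1 Ia.2)).
Proof.
move=> [I a] [J b] /= [eqIJ eqR].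
have {}eqR c : val I (lift a c) = val J (lift b c).
  by move/ffunP/(_ c): eqR; rewrite !ffunE.
have eq_IJ : I = J.
  apply: multi_index_eq => i; case: (unliftP a i) => [c|] ->.
    by rewrite eqR codom_f.
  by rewrite eqIJ codom_f.
by rewrite -eq_IJ in eqIJ *; rewrite (multi_index_inj eqIJ).
Qed.

Lemma ler_sum_inj (R : numDomainType) (S T : finType) (h : S -> T)
    (f : T -> R) :
  injective h -> (forall y, 0 <= f y) -> \sum_x f (h x) <= \sum_y f y.
Proof.
move=> h_inj f_ge0.
have <- : \sum_(y in h @: [set: S]%SET) f y = \sum_x f (h x).
  rewrite big_imset => [|x y _ _]; last exact: h_inj.
  by apply: eq_bigl => x; rewrite inE.
by rewrite big_mkcond; apply: ler_sum => y _; case: ifP.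
Qed.

(** * Exterior multiplication by a vector *)

Definition wcons (R : realType) n p (u : 'rV[R]_n) (v : 'I_p -> 'rV[R]_n)
    (i : 'I_p.+1) : 'rV[R]_n :=
  if unlift ord0 i is Some j then v j else u.

Lemma wcons0 (R : realType) n p (u : 'rV[R]_n) (v : 'I_p -> 'rV[R]_n) :
  wcons u v ord0 = u.
Proof. by rewrite /wcons unlift_none. Qed.

Lemma wconsS (R : realType) n p (u : 'rV[R]_n) (v : 'I_p -> 'rV[R]_n) i :
  wcons u v (lift ord0 i) = v i.
Proof. by rewrite /wcons liftK. Qed.

(** The product u /\ xi.  For simple xi its coordinates are minors of a matrix
    with first row u; their Laplace expansion along that row is linear in xi and
    so makes sense for all xi. *)
Definition vwedge (R : realType) n p (u : 'rV[R]_n) (xi : pvector R n p) :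
    pvector R n p.+1 :=
  [ffun I : multi_index n p.+1 =>
    \sum_(a < p.+1) (-1) ^+ a * u 0 (val I a) * (xi (mi_remove I a) : R)].

Fact vwedge_is_linear (R : realType) n p (u : 'rV[R]_n) :
  linear (@vwedge R n p u).
Proof.
move=> c xi eta; apply/ffunP => I; rewrite !ffunE.
rewrite scaler_sumr -big_split /=; apply: eq_bigr => a _.
by rewrite !ffunE mulrDr; congr (_ + _); exact: mulrCA.
Qed.

HB.instance Definition _ (R : realType) n p (u : 'rV[R]_n) :=
  GRing.isLinear.Build R (pvector R n p) (pvector R n p.+1) _
    (@vwedge R n p u) (@vwedge_is_linear R n p u).

Lemma wedge_wcons (R : realType) n p (u : 'rV[R]_n) (v : 'I_p -> 'rV[R]_n) :
  wedge (wcons u v) = vwedge u (wedge v).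
Proof.
apply/ffunP => I; rewrite !ffunE (expand_det_row _ ord0); apply: eq_bigr => a _.
rewrite !mxE wcons0 ffunE /cofactor add0n mulrCA -!mulrA; congr (_ * (_ * _)).
by congr (\det _); apply/matrixP => i j; rewrite !mxE wconsS mi_removeE.
Qed.

Lemma pvector_norm_sqr (R : realType) n p (xi : pvector R n p) :
  pvector_norm xi ^+ 2 = \sum_I (xi I : R) ^+ 2.
Proof. by rewrite sqr_sqrtr // sumr_ge0 // => I _; rewrite sqr_ge0. Qed.

Lemma pcovector_norm_sqr (R : realType) n p (phi : pcovector R n p) :
  pcovector_norm phi ^+ 2 = \sum_I (phi (basis_pvector R I) : R) ^+ 2.
Proof. by rewrite sqr_sqrtr // sumr_ge0 // => I _; rewrite sqr_ge0. Qed.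

(** The entries of I are distinct, so at most one term of the Laplace sum is
    nonzero, and squaring removes its sign. *)
Lemma evwedge_sqr (R : realType) n p (j : 'I_n) (xi : pvector R n p) I :
  (vwedge (delta_mx 0 j) xi I : R) ^+ 2 =
  \sum_a (val I a == j)%:R * (xi (mi_remove I a) : R) ^+ 2.
Proof.
rewrite ffunE; case: (pickP (fun a => val I a == j)) => [a /eqP Ia|noI].
  have Ib b : b != a -> (val I b == j) = false.
    by move/negbTE; rewrite -Ia (inj_eq (@multi_index_inj _ _ I)).
  rewrite (bigD1 a) //= [in RHS](bigD1 a) //= !big1 => [|b /Ib Nb|b /Ib Nb].
  - by rewrite !addr0 mxE Ia !eqxx mulr1 mul1r exprMn sqrr_sign mul1r.
  - by rewrite Nb mul0r.
  - by rewrite mxE Nb mulr0 mul0r.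
rewrite !big1 ?expr0n // => a _; rewrite ?mxE noI ?mul0r //.
by rewrite mulr0 mul0r.
Qed.

(** By [mi_remove_inj], distinct I containing j read off distinct coordinates of
    xi: e_j /\ xi lists, up to sign, some of the coordinates of xi. *)
Lemma pvector_norm_evwedge (R : realType) n p (j : 'I_n) (xi : pvector R n p) :
  pvector_norm (vwedge (delta_mx 0 j) xi) <= pvector_norm xi.
Proof.
rewrite -ler_sqr ?nnegrE ?sqrtr_ge0 // !pvector_norm_sqr.
under eq_bigr do rewrite evwedge_sqr.
pose f (jK : 'I_n * multi_index n p) : R :=
  (jK.1 == j)%:R * (xi jK.2 : R) ^+ 2.
rewrite pair_big /=.
apply: le_trans (ler_sum_inj (f := f) (@mi_remove_inj n p) _) _.
  by move=> [i K]; rewrite mulr_ge0 ?ler0n ?sqr_ge0.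
rewrite -(pair_big xpredT xpredT (fun i K => f (i, K))) /= (bigD1 j) //=.
rewrite [X in _ + X]big1 => [|i /negbTE neq_ij]; last first.
  by rewrite big1 // => K _; rewrite /f /= neq_ij mul0r.
by rewrite addr0; apply: ler_sum => K _; rewrite /f /= eqxx mul1r.
Qed.

(** Only (J, b) = (I, a) has J b = I a and the same remaining entries, whence
    the single nonzero coordinate and its Laplace sign. *)
Lemma evwedge_basis (R : realType) n p (I : multi_index n p.+1) (a : 'I_p.+1) :
  vwedge (delta_mx 0 (val I a)) (basis_pvector R (mi_remove I a)) =
  (-1) ^+ a *: basis_pvector R I.
Proof.
apply/ffunP => J; rewrite [LHS]ffunE [RHS]ffunE wedge_basis.
have eqJ b : (val J b == val I a) && (mi_remove J b == mi_remove I a) =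
    ((J, b) == (I, a)).
  by rewrite -(inj_eq (@mi_remove_inj n p)).
rewrite (bigD1 a) //= big1 => [|b neq_ba]; last first.
  rewrite wedge_basis mxE -mulrA eqxx /= -natrM mulnb eqJ xpair_eqE.
  by rewrite (negbTE neq_ba) andbF mulr0.
rewrite wedge_basis mxE -mulrA eqxx /= -natrM mulnb eqJ xpair_eqE eqxx.
by rewrite andbT addr0.
Qed.

(** * Contraction of a covector by a basis vector *)

Definition contraction (R : realType) n p (j : 'I_n)
    (phi : pcovector R n p.+1) : pcovector R n p :=
  (phi \o linfun (vwedge (delta_mx 0 j)))%VF.

Lemma contractionE (R : realType) n p (j : 'I_n) (phi : pcovector R n p.+1) xi :
  contraction j phi xi = phi (vwedge (delta_mx 0 j) xi).
Proof. by rewrite comp_lfunE lfunE. Qed.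

Lemma contraction_wedge (R : realType) n p (j : 'I_n) (phi : pcovector R n p.+1)
    (v : 'I_p -> 'rV[R]_n) :
  contraction j phi (wedge v) = phi (wedge (wcons (delta_mx 0 j) v)).
Proof. by rewrite contractionE wedge_wcons. Qed.

Lemma comass_ge0 (R : realType) n p (phi : pcovector R n p) :
  (0 < p)%N -> 0 <= comass phi.
Proof.
move=> p_gt0; have [->|/(comass_gt0 p_gt0)/ltW //] := eqVneq phi 0.
have [[_ [xi xiP _]] bnd] := comass_has_sup (0 : pcovector R n p) p_gt0.
by apply: ub_le_sup => //; exists xi => //; rewrite lfunE.
Qed.

Lemma comass_contraction (R : realType) n p (j : 'I_n)
    (phi : pcovector R n p.+1) :
  (0 < p)%N -> comass (contraction j phi) <= comass phi.
Proof.
move=> p_gt0; apply: ge_sup; first exact: (comass_has_sup _ p_gt0).1.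
move=> _ [_ [[v ->] v_le1] <-]; apply: ub_le_sup.
  exact: (comass_has_sup phi _).2.
exists (wedge (wcons (delta_mx 0 j) v)); last by rewrite contraction_wedge.
split; first by eexists.
by rewrite wedge_wcons; apply: le_trans (pvector_norm_evwedge _ _) v_le1.
Qed.

(** The coordinate phi (e_I) recurs, up to sign, as a coordinate of phi_j for
    each of the p + 1 entries j of I, and by [mi_remove_inj] these places are
    all different. *)
Lemma sum_contraction_norm (R : realType) n p (phi : pcovector R n p.+1) :
  p.+1%:R * pcovector_norm phi ^+ 2 <=
  \sum_j pcovector_norm (contraction j phi) ^+ 2.
Proof.
under eq_bigr do rewrite pcovector_norm_sqr.
pose f (jK : 'I_n * multi_index n p) : R :=
  (contraction jK.1 phi (basis_pvector R jK.2) : R) ^+ 2.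
rewrite (pair_big _ _ (fun j K => f (j, K))) /=.
have -> : \sum_jK f (jK.1, jK.2) = \sum_jK f jK by apply: eq_bigr => -[].
have f_ge0 jK : 0 <= f jK by rewrite sqr_ge0.
apply: le_trans (ler_sum_inj (@mi_remove_inj n p) f_ge0).
rewrite -(pair_big xpredT xpredT
  (fun (I : multi_index n p.+1) (a : 'I_p.+1) => f (val I a, mi_remove I a))).
rewrite /= pcovector_norm_sqr mulr_sumr.
apply: ler_sum => I _; rewrite mulr_natl -[X in _ *+ X]card_ord -sumr_const.
apply: ler_sum => a _; rewrite /f contractionE evwedge_basis linearZ /=.
by rewrite [_ *: _]/(_ * _) exprMn sqrr_sign mul1r.
Qed.

(** * Iterated contraction *)

(** The condition that no e_a^* with a in A occurs in phi.  Asking it of wedges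
    of arbitrary vectors, not only of basis p-vectors, avoids sorting indices
    when a further factor e_j is put in front. *)
Definition kills (R : realType) n p (A : {set 'I_n}) (phi : pcovector R n p) :=
  forall (v : 'I_p -> 'rV[R]_n) i a,
    a \in A -> v i = delta_mx 0 a -> phi (wedge v) = 0.

Lemma kills_contraction (R : realType) n p (A : {set 'I_n}) j
    (phi : pcovector R n p.+1) :
  kills A phi -> kills (j |: A) (contraction j phi).
Proof.
move=> phiA v i a; rewrite contraction_wedge in_setU1 => /orP[/eqP ->|aA] vi.
  rewrite (@wedge_alternating _ _ _ ord0 (lift ord0 i)) ?linear0 ?neq_lift //.
  by rewrite wcons0 wconsS.
by apply: (phiA _ (lift ord0 i) a) => //; rewrite wconsS.
Qed.

Lemma contraction_kills (R : realType) n p (A : {set 'I_n}) j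
    (phi : pcovector R n p.+1) :
  kills A phi -> j \in A -> pcovector_norm (contraction j phi) = 0.
Proof.
move=> phiA jA; rewrite /pcovector_norm big1 ?sqrtr0 // => I _.
rewrite contraction_wedge (phiA _ ord0 j) ?wcons0 //; exact: expr0n.
Qed.

Lemma norm_le_comass (R : realType) n k (phi : pcovector R n k) :
  (0 < k <= n)%N ->
  pcovector_norm phi ^+ 2 <= comass_const R n k ^+ 2 * comass phi ^+ 2.
Proof.
move=> k_bnd; have k_gt0 : (0 < k)%N by case/andP: k_bnd.
have [->|phi_neq0] := eqVneq phi 0.
  rewrite pcovector_norm_sqr big1 => [|I _]; last first.
    by rewrite lfunE; exact: expr0n.
  by apply: mulr_ge0; exact: sqr_ge0.
have c_gt0 := comass_gt0 k_gt0 phi_neq0.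
have le_C : pcovector_norm phi <= comass_const R n k * comass phi.
  rewrite -ler_pdivrMr //; apply: ub_le_sup; last by exists phi.
  exact: (comass_const_has_sup R k_bnd).2.
by rewrite -exprMn lerXn2r ?nnegrE ?sqrtr_ge0 // (le_trans _ le_C) ?sqrtr_ge0.
Qed.

Lemma comass_const_ge0 (R : realType) n p :
  (0 < p <= n)%N -> 0 <= comass_const R n p.
Proof.
move=> p_bnd; have p_gt0 : (0 < p)%N by case/andP: p_bnd.
have [[x [phi phi_neq0 def_x]] bnd] := comass_const_has_sup R p_bnd.
apply: (@le_trans _ _ x); last by apply: ub_le_sup => //; exists phi.
by rewrite -def_x divr_ge0 ?sqrtr_ge0 ?comass_ge0.
Qed.

(** Contracting by e_j uses up the index j: in the sum over j only the n - #|A|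
    indices outside A contribute, and phi_j then kills one more basis vector.
    This is why the bound is a falling factorial and not a power of n. *)
Lemma norm_le_comass_kills (R : realType) n k q (A : {set 'I_n})
    (phi : pcovector R n (q + k)) :
  (0 < k <= n)%N -> kills A phi ->
  ((q + k) ^_ q)%:R * pcovector_norm phi ^+ 2 <=
  ((n - #|A|) ^_ q)%:R * (comass_const R n k ^+ 2 * comass phi ^+ 2).
Proof.
move=> k_bnd; have k_gt0 : (0 < k)%N by case/andP: k_bnd.
elim: q A phi => [|q IHq] A phi phiA; first by rewrite !mul1r norm_le_comass.
rewrite (ffactSS (q + k) q) natrM mulrAC.
apply: le_trans (ler_wpM2r (ler0n _ _) (sum_contraction_norm phi)) _.
rewrite mulr_suml (bigID (mem A)) /= big1 ?add0r => [|j jA]; last first.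
  by rewrite (contraction_kills phiA) // expr0n mul0r.
have cardA : (n - #|A|)%N = #|~: A|.
  by rewrite [RHS]cardsCs finset.setCK card_ord.
rewrite ffactnS natrM -mulrA {1}cardA mulr_natl.
rewrite -sumr_const big_mkcond [leRHS]big_mkcond /=; apply: ler_sum => j _.
rewrite finset.in_setC; case: ifP => // jNA; rewrite mulrC.
apply: le_trans (IHq _ _ (kills_contraction phiA)) _.
rewrite cardsU1 jNA add1n subnS.
rewrite !ler_wpM2l ?ler0n ?sqr_ge0 // lerXn2r ?nnegrE ?comass_ge0 //.
- by rewrite addn_gt0 k_gt0 orbT.
- by apply: comass_contraction; rewrite addn_gt0 k_gt0 orbT.
Qed.

Theorem proposition2p5 (R : realType) (k p n : nat)
    (k_ge1 : (1 <= k)%N) (lt_kp : (k < p)%N) (lt_pn : (p < n)%N) :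
  comass_const R n p ^+ 2 <=
    'C(n, p - k)%:R / 'C(p, k)%:R * comass_const R n k ^+ 2.
Proof.
have k_bnd : (0 < k <= n)%N by rewrite k_ge1 ltnW // (ltn_trans lt_kp).
rewrite -(bin_sub (ltnW lt_kp)); move: (p - k)%N (subnK (ltnW lt_kp)) => q.
move=> def_p; subst p; have qk_gt0 : (0 < q + k)%N by exact: leq_trans lt_kp.
have b_gt0 : 0 < 'C(q + k, q)%:R :> R by rewrite ltr0n bin_gt0 leq_addr.
set B := (X in _ <= X); have B_ge0 : 0 <= B.
  by rewrite mulr_ge0 ?sqr_ge0 // divr_ge0 ?ler0n.
have sup_le : comass_const R n (q + k) <= Num.sqrt B.
  apply: ge_sup => [|_ [phi phi_neq0 <-]].
    by apply: (comass_const_has_sup R _).1; rewrite qk_gt0 ltnW.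
  have c_gt0 := comass_gt0 qk_gt0 phi_neq0.
  rewrite -ler_sqr ?nnegrE ?sqrtr_ge0 ?divr_ge0 ?sqrtr_ge0 ?(ltW c_gt0) //.
  rewrite sqr_sqrtr // expr_div_n ler_pdivrMr ?exprn_gt0 // /B.
  rewrite -[leRHS]mulrA [leRHS]mulrAC ler_pdivlMr // mulrC.
  (* Multiplying by q! turns binomial coefficients into falling factorials. *)
  rewrite -(ler_pM2l (_ : 0 < q`!%:R)).
    have killed0 : kills finset.set0 phi by move=> v i a; rewrite inE.
    rewrite [leLHS]mulrA [leRHS]mulrA -!natrM ![(q`! * _)%N]mulnC !bin_ffact.
    by have := norm_le_comass_kills k_bnd killed0; rewrite cards0 subn0.
  by rewrite ltr0n fact_gt0.
rewrite -[leRHS]sqr_sqrtr // lerXn2r ?nnegrE ?sqrtr_ge0 //.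
by rewrite comass_const_ge0 // qk_gt0 ltnW.
Qed.
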